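(* Let $N\ge 5$ and let ${\cal C}_N$ be the moduli space of strictly convex equilateral $N$-gons, equipped with the algebraic hyperbolic structure, so that each similarity class $[L]\in{\cal C}_N$ is identified with a point of $\mathbb{H}^{N-3}$. Then a similarity class $[L]\in{\cal C}_N$ has a representative all of whose vertices have algebraic coordinates if and only if the corresponding point of $\mathbb{H}^{N-3}$ has algebraic coordinates.
   Context: Polygons. All polygons are labelled, strictly convex, and oriented counterclockwise, and are considered up to orientation-preserving similarity. Equilateral means all sides have the same length; equiangular means all interior angles are equal. ${\cal C}_N$ is the set of similarity classes of strictly convex equilateral $N$-gons. Sunbursts. An $N$-sunburst is a collection of $N$ distinct rays from the origin whose convex hull is the plane. In a pair $(A,B)$ the rays are labelled in counterclockwise order $A_1,A_3,\dots,A_{2N-1}$ and $B_2,B_4,\dots,B_{2N}$, indices mod $2N$. The regular $N$-sunburst has rays through the $N$th roots of unity. A sunburst is balanced if its outward unit vectors sum to $0$. The correspondence $[L]\mapsto[P_L]$. Let $L$ be a strictly convex equilateral $N$-gon with unit edge vectors $\beta_2,\beta_4,\dots,\beta_{2N}$ in order. Let $B_k$ be the ray from $0$ containing $\beta_k$; $B$ is a balanced $N$-sunburst. Let $A$ be the regular $N$-sunburst. There is a unique rotation $B'$ of $B$ about the origin for which there exist counterclockwise convex $N$-gons with vertices $a_k\in A_k\setminus\{0\}$ ($k$ odd) and $b_k\in B'_k\setminus\{0\}$ ($k$ even) such that $a_{k+1}-a_{k-1}$ is a positive multiple of the inward (toward the origin) direction of $B'_k$ for $k$ even and $b_{k+1}-b_{k-1}$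 is a positive multiple of the outward direction of $A_k$ for $k$ odd. Then $P_L$ is the convex equiangular $N$-gon with vertices $b_2,b_4,\dots,b_{2N}$. The map $[L]\mapsto[P_L]$ is a well-defined bijection from similarity classes of strictly convex equilateral $N$-gons to similarity classes of strictly convex equiangular $N$-gons. Hyperbolic structure. Normalize equiangular $N$-gons by rotation so that the successive sides are parallel to the successive $N$th roots of unity $\omega^j$. A (possibly non-convex or degenerate) equiangular $N$-gon is then a choice of lines $\ell_1,\dots,\ell_N$ with $\ell_j=\{x:\langle x,n_j\rangle=h_j\}$, where $n_j$ is the unit normal $-i\omega^j$ and $h_j\in\mathbb{R}$; its vertices are $\ell_j\cap\ell_{j+1}$. Modulo translations the space of such polygons is a real vector space of dimension $N-2$, identified with $\mathbb{R}^{N-2}$ by linear coordinates that are linear functions of $(h_1,\dots,h_N)$ with algebraic coefficients (different such choices differ by an invertible matrix with algebraic entries). In these coordinates the signed area is $Q(V,V)$ for a quadratic form $Q$ with algebraic coefficients and signature $(1,N-3)$. Each similarity class of strictly convex equiangular $N$-gons has a unique area-one representative modulo translation, and so corresponds to a unique vector $V$ on one sheet of the hyperboloid $\{Q(V,V)=1\}$, which is the Lorentz model of $\mathbb{H}^{N-3}$. The image is the interior of a convex polytope. The algebraic hyperbolic structure on ${\cal C}_N$ is obtained by identifying $[L]$ with the point $V\in\mathbb{H}^{N-3}$ of $[P_L]$. A point of $\mathbb{H}^{N-3}$ has algebraic coordinates if all coordinates of $V$ are algebraic numbers. *)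

(* Defs.v *)
From HB Require Import structures.
From mathcomp Require Import all_boot all_order all_algebra.
From mathcomp Require Import complex.
From mathcomp Require Import all_classical all_reals all_analysis.
From mathcomp Require Import ring lra.

Set Implicit Arguments.
Unset Strict Implicit.
Unset Printing Implicit Defensive.

Import Order.TTheory GRing.Theory Num.Theory.

Local Open Scope ring_scope.
Local Open Scope complex_scope.

(* The plane is R[i].  Labelled N-gons are functions P : 'I_N -> R[i] listing
   the vertices; labels are cyclic, with successor ordS and predecessor
   ord_pred. *)

Section Plane.
Variable R : realType.

Definition dot (z w : R[i]) : R :=
  complex.Re z * complex.Re w + complex.Im z * complex.Im w.

Definition cross (z w : R[i]) : R :=
  complex.Re z * complex.Im w - complex.Im z * complex.Re w.

(* The ray from 0 in direction d, without its origin; equivalently, the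
   positive multiples of d. *)
Definition on_ray (d z : R[i]) : Prop := exists2 t : R, 0 < t & z = t%:C * d.

Definition algebraic_number (x : R) : Prop := algebraicOver (@ratr R) x.

Definition algebraic_point (z : R[i]) : Prop :=
  algebraic_number (complex.Re z) /\ algebraic_number (complex.Im z).

Definition algebraic_matrix m n (A : 'M[R]_(m, n)) : Prop :=
  forall i j, algebraic_number (A i j).

End Plane.

Section Polygons.
Variables (R : realType) (N : nat).
Implicit Types P Q L : 'I_N -> R[i].

Definition edge P (k : 'I_N) : R[i] := P (ordS k) - P k.

(* Strict convexity with counterclockwise orientation: every vertex off a side
   lies strictly to the left of the line through that side.  This makes the
   polygon simple, with winding number one. *)
Definition strictly_convex P : Prop :=
  forall k l : 'I_N, l != k -> l != ordS k -> 0 < cross (edge P k) (P l - P k).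

Definition equilateral P : Prop :=
  forall k l : 'I_N, `|edge P k| = `|edge P l|.

Definition similar_polygon P Q : Prop :=
  exists c d : R[i], c != 0 /\ forall k, Q k = c * P k + d.

Definition algebraic_polygon P : Prop := forall k, algebraic_point (P k).

Definition signed_area P : R := (\sum_(k < N) cross (P k) (P (ordS k))) / 2.

Definition unit_edge L (k : 'I_N) : R[i] := edge L k / `|edge L k|.

End Polygons.

Section EquiangularPolygons.
Variables (R : realType) (N : nat).
Implicit Types (P Q L : 'I_N -> R[i]) (h : 'rV[R]_N).

Definition angle_step : R := 2 * pi / N%:R.

Definition omega : R[i] := cos angle_step +i* sin angle_step.

Definition side_direction (k : 'I_N) : R[i] := omega ^+ k.

Definition side_normal (k : 'I_N) : R[i] := (0 -i* 1) * omega ^+ k.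

(* [is_P L b] says that b is the equiangular polygon P_L attached to L.  Let
   A_1, A_3, ..., A_{2N-1} be the rays through the N-th roots of unity and
   B_2, B_4, ..., B_{2N} those through the unit edge vectors of L.  P_L is the
   polygon b_2, ..., b_{2N} with b_k on B'_k, where B' is the rotation of B for
   which there is a polygon a_1, ..., a_{2N-1} with a_k on A_k such that
   a_{k+1} - a_{k-1} points along -B'_k and b_{k+1} - b_{k-1} along A_k.
   Both 2k+1 and 2k+2 (indices mod 2N) are encoded by k : 'I_N, so that
     a_{2k+3} - a_{2k+1} = a (ordS k) - a k,
     b_{2k+2} - b_{2k}   = b k - b (ord_pred k).
   The rotation taking B to B' is multiplication by u. *)
Definition is_P L (b : 'I_N -> R[i]) : Prop :=
  strictly_convex b /\
  exists (u : R[i]) (a : 'I_N -> R[i]),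
    let B' k := u * unit_edge L k in
    [/\ `|u| = 1,
        strictly_convex a,
        forall k, on_ray (side_direction k) (a k) /\ on_ray (B' k) (b k),
        forall k, on_ray (- B' k) (a (ordS k) - a k) &
        forall k, on_ray (side_direction k) (b k - b (ord_pred k))].

Definition normalized P : Prop :=
  forall k, on_ray (side_direction k) (P k - P (ord_pred k)).

(* A vector h stands for the lines l_k = {x : <x, n_k> = h_k}.  The possibly
   non-convex or degenerate polygon with these side lines has k-th vertex
   l_k /\ l_{k+1}; see [vertexP]. *)
Definition side_line (h : 'rV[R]_N) (k : 'I_N) (x : R[i]) : Prop :=
  dot x (side_normal k) = h 0 k.

Definition vertex h (k : 'I_N) : R[i] :=
  (h 0 k)%:C * side_normal k +
  ((h 0 (ordS k) - cos angle_step * h 0 k) / sin angle_step)%:C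
    * side_direction k.

Lemma omegaX n : omega ^+ n = cos (angle_step * n%:R) +i* sin (angle_step * n%:R).
Proof.
elim: n => [|n IHn]; first by rewrite expr0 mulr0 cos0 sin0.
rewrite exprSr IHn -addn1 natrD mulrDr mulr1 cosD sinD.
by apply/eqP; rewrite eq_complex /= eqxx /= addrC eqxx.
Qed.

Lemma omegaXN : (0 < N)%N -> omega ^+ N = 1.
Proof.
move=> N0; rewrite omegaX.
have -> : angle_step * N%:R = pi *+ 2.
  by rewrite /angle_step divfK ?mulr_natl // pnatr_eq0 -lt0n.
by rewrite -[pi *+ 2]add0r cosD2pi sinD2pi cos0 sin0.
Qed.

Lemma omegaS (k : 'I_N) : omega ^+ ordS k = omega ^+ k * omega.
Proof.
have N0 : (0 < N)%N by apply: leq_ltn_trans (ltn_ord k).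
rewrite -exprSr /= [in RHS](divn_eq k.+1 N) exprD mulnC exprM omegaXN //.
by rewrite expr1n mul1r.
Qed.

Lemma sin_angle_step_gt0 : (2 < N)%N -> 0 < sin angle_step.
Proof.
move=> N2; apply: sin_gt0_pi.
have N0 : 0 < N%:R :> R by rewrite ltr0n (leq_trans _ N2).
rewrite /angle_step divr_gt0 ?mulr_gt0 ?pi_gt0 //= ltr_pdivrMr //.
by rewrite mulrC ltr_pM2l ?pi_gt0 // ltr_nat.
Qed.

Lemma vertexP h k : (2 < N)%N ->
  side_line h k (vertex h k) /\ side_line h (ordS k) (vertex h k).
Proof.
move=> N2; have s0 := lt0r_neq0 (sin_angle_step_gt0 N2).
rewrite /side_line /vertex /side_normal /side_direction omegaS omegaX /omega.
rewrite /dot /=; have := cos2Dsin2 (angle_step * (k : nat)%:R).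
set c := cos (_ * _); set s := sin (_ * _) => cs.
move: (h 0 k) (h 0 (ordS k)) => x y; split.
  by transitivity (x * (c ^+ 2 + s ^+ 2)); [field | rewrite cs mulr1].
by transitivity (y * (c ^+ 2 + s ^+ 2)); [field | rewrite cs mulr1].
Qed.

(* The line heights of a polygon with sides parallel to the side directions. *)
Definition heights P : 'rV[R]_N := \row_k dot (P k) (side_normal k).

(* The vector by which h changes when the polygon is translated by t. *)
Definition translation (t : R[i]) : 'rV[R]_N := \row_k dot t (side_normal k).

(* Linear coordinates, with algebraic coefficients, on the space of equiangular
   polygons modulo translations.  For N >= 3 the translations form a plane, so
   h |-> h *m Phi induces an isomorphism onto R^(N-2). *)
Definition algebraic_chart (Phi : 'M[R]_(N, N - 2)) : Prop :=
  algebraic_matrix Phi /\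
  forall h, h *m Phi = 0 <-> exists t, h = translation t.

(* The quadratic form V |-> Q(V, V): the signed area of any polygon with
   coordinates V; see [area_formE]. *)
Definition area_form (Phi : 'M[R]_(N, N - 2)) (V : 'rV[R]_(N - 2)) : R :=
  signed_area (vertex (V *m pinvmx Phi)).

Lemma vertexD h h' k : vertex (h + h') k = vertex h k + vertex h' k.
Proof.
rewrite /vertex !mxE; case: (side_normal k) (side_direction k) => a b [c d].
apply/eqP; rewrite eq_complex /=.
by apply/andP; split; apply/eqP; ring.
Qed.

Lemma vertex_translation t k : (2 < N)%N -> vertex (translation t) k = t.
Proof.
move=> N2; have s0 := lt0r_neq0 (sin_angle_step_gt0 N2).
rewrite /vertex !mxE /side_normal /side_direction omegaS omegaX /omega /dot.
have := cos2Dsin2 (angle_step * (k : nat)%:R).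
case: t => x y /=; set c := cos (_ * _); set s := sin (_ * _) => cs.
apply/eqP; rewrite eq_complex /=; apply/andP; split; apply/eqP.
  by transitivity (x * (c ^+ 2 + s ^+ 2)); [field | rewrite cs mulr1].
by transitivity (y * (c ^+ 2 + s ^+ 2)); [field | rewrite cs mulr1].
Qed.

Lemma vertex_heights P k : (2 < N)%N -> normalized P ->
  vertex (heights P) k = P k.
Proof.
move=> N2 nP; rewrite -[RHS](vertex_translation (P k) k N2) /vertex !mxE.
suff -> : dot (P (ordS k)) (side_normal (ordS k)) =
          dot (P k) (side_normal (ordS k)) by [].
have [t _] := nP (ordS k); rewrite ordSK => /eqP; rewrite subr_eq => /eqP ->.
rewrite /side_normal /side_direction /dot.
case: (omega ^+ _) (P k) => a b [x y] /=; ring.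
Qed.

Lemma sum_ordS (V : nmodType) (F : 'I_N -> V) :
  \sum_(k < N) F (ordS k) = \sum_(k < N) F k.
Proof. by rewrite [RHS](reindex_inj (@ordS_inj N)). Qed.

Lemma signed_area_translate P t :
  signed_area (fun k => P k + t) = signed_area P.
Proof.
rewrite /signed_area; congr (_ / 2).
pose G k := cross t (P k).
transitivity (\sum_(k < N) (cross (P k) (P (ordS k)) + (G (ordS k) - G k))).
  apply: eq_bigr => k _; rewrite /G /cross; case: (t) => ? ?.
  case: (P k) => ? ?; case: (P (ordS k)) => ? ? /=; ring.
rewrite big_split /= -[RHS]addr0; congr (_ + _).
by rewrite sumrB (sum_ordS G) subrr.
Qed.

Lemma area_formE Phi h : (2 < N)%N -> algebraic_chart Phi ->
  area_form Phi (h *m Phi) = signed_area (vertex h).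
Proof.
move=> N2 [_ Phi0]; rewrite /area_form; set h' := _ *m pinvmx _.
have /Phi0[t ht] : (h' - h) *m Phi = 0.
  by rewrite mulmxBl mulmxKpV ?submxMl // subrr.
rewrite -(signed_area_translate (vertex h) t); congr signed_area.
apply/funext => k.
by rewrite -(subrK h h') ht vertexD vertex_translation // addrC.
Qed.

Definition lorentz_product (Phi : 'M[R]_(N, N - 2)) (V W : 'rV[R]_(N - 2)) : R :=
  (area_form Phi (V + W) - area_form Phi V - area_form Phi W) / 2.

(* H^(N-3): the sheet of the hyperboloid Q(V, V) = 1 that contains the regular
   polygons, whose line heights are constant and positive. *)
Definition hyperbolic_space (Phi : 'M[R]_(N, N - 2)) : set 'rV[R]_(N - 2) :=
  [set V | area_form Phi V = 1 /\
           0 < lorentz_product Phi V (const_mx 1 *m Phi)].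

(* V is the point of H^(N-3) identified with the class of L.  Since
   area_form Phi V = 1, the representative P' has area one; see [area_formE]
   and [vertex_heights]. *)
Definition point_of (Phi : 'M[R]_(N, N - 2)) L (V : 'rV[R]_(N - 2)) : Prop :=
  hyperbolic_space Phi V /\
  exists b P', [/\ is_P L b, similar_polygon b P', normalized P' &
                   V = heights P' *m Phi].

End EquiangularPolygons.

(* Main.v *)
Require Import Defs.
From HB Require Import structures.
From mathcomp Require Import all_boot all_order all_algebra.
From mathcomp Require Import complex.
From mathcomp Require Import all_classical all_reals all_analysis.
From mathcomp Require Import ring zify.

Set Implicit Arguments.
Unset Strict Implicit.
Unset Printing Implicit Defensive.

Import Order.TTheory GRing.Theory Num.Theory.

Local Open Scope ring_scope.
Local Open Scope complex_scope.

(* A real number is algebraic if and only if every derivation of R kills it.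
   So it suffices to compare the derivatives of both sides under a derivation D.

   Write w_k for the unit vector along B'_k, and a_k = s_k omega^k,
   b_k = r_k w_k.  If L is algebraic up to similarity, then the w_k are
   algebraic up to a common rotation, so D rotates all of them with the same
   angular velocity tau.  Differentiating the relations between consecutive s_k
   logarithmically and summing around the polygon gives tau times a positive
   number equal to 0, so the w_k are constant.  Then the r_k all have the same
   logarithmic derivative, and since V is normalized by the area it is constant.

   Conversely, if V is constant, then D acts on the b_k as an infinitesimal
   homothety followed by a translation.  As the w_k sum to 0, the origin is the
   geometric median of the b_k, and strict convexity of the sum of distances
   shows that the w_k are constant.  They are the edges of a polygon similar to
   L. *)

(** * Derivations detect algebraic numbers *)

Section PartialDerivations.
Variable F : numFieldType.
Implicit Types (G : set (F * F)) (f g : {poly F}).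

(* A derivation on a subring of [F], given by its graph. *)
Definition partial_derivation G : Prop :=
  [/\ G (1, 0),
      forall x x' y y', G (x, x') -> G (y, y') -> G (x - y, x' - y'),
      forall x x' y y', G (x, x') -> G (y, y') -> G (x * y, x' * y + x * y') &
      forall x', G (0, x') -> x' = 0].

(** So [g] is [f] differentiated coefficientwise. Since [G] is only a relation, the two polynomials
    are carried along together. *)
Definition coefs_in G f g : Prop := forall i, G (f`_i, g`_i).

(* The derivation of the subring generated by the domain of [G] and [z] that
   extends [G] and maps [z] to [w]. *)
Definition adjoin G (z w : F) : set (F * F) :=
  [set u | exists f g, coefs_in G f g /\
                       u = (f.[z], g.[z] + f^`().[z] * w)]%classic.

Section Extension.
Variable G : set (F * F).
Hypothesis pdG : partial_derivation G.

Lemma pd0 : G (0, 0).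
Proof. by case: pdG => G1 GB _ _; have := GB _ _ _ _ G1 G1; rewrite !subrr. Qed.

Lemma pdB x x' y y' : G (x, x') -> G (y, y') -> G (x - y, x' - y').
Proof. by case: pdG => _ GB _ _; exact: GB. Qed.

Lemma pdD x x' y y' : G (x, x') -> G (y, y') -> G (x + y, x' + y').
Proof.
move=> Gx Gy; rewrite -[y]opprK -[y']opprK; apply: pdB => //.
by rewrite -sub0r -[- y']sub0r; exact: pdB pd0 Gy.
Qed.

Lemma pdM x x' y y' : G (x, x') -> G (y, y') -> G (x * y, x' * y + x * y').
Proof. by case: pdG => _ _ GM _; exact: GM. Qed.

Lemma pd_sum n (a b : 'I_n -> F) : (forall i, G (a i, b i)) ->
  G (\sum_i a i, \sum_i b i).
Proof.
move=> Gab; elim/big_ind2: _ => //; first exact: pd0.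
by move=> x x' y y' Gx Gy; exact: pdD.
Qed.

Lemma coefs_inB f g f1 g1 :
  coefs_in G f g -> coefs_in G f1 g1 -> coefs_in G (f - f1) (g - g1).
Proof. by move=> Gf Gf1 i; rewrite !coefB; exact: pdB. Qed.

Lemma coefs_inM f g f1 g1 : coefs_in G f g -> coefs_in G f1 g1 ->
  coefs_in G (f * f1) (g * f1 + f * g1).
Proof.
move=> Gf Gf1 i; rewrite coefD !coefM -big_split /=; apply: pd_sum => j.
exact: pdM.
Qed.

Lemma coefs_inC x x' : G (x, x') -> coefs_in G x%:P x'%:P.
Proof. by move=> Gx i; rewrite !coefC; case: eqP => // _; exact: pd0. Qed.

Lemma coefs_inXn n : coefs_in G 'X^n 0.
Proof.
move=> i; rewrite coefXn coef0; case: eqP => // _; last exact: pd0.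
by case: pdG.
Qed.

Lemma coefs_in_deriv f g : coefs_in G f g -> coefs_in G f^`() g^`().
Proof.
move=> Gf i; rewrite !coef_deriv.
elim: {2 4}i.+1 => [|n IHn]; first exact: pd0.
by rewrite !mulrSr; exact: pdD.
Qed.

(** The hypothesis says that every expression of 0 as a polynomial in [z] has derivative 0; by
    additivity the derivative of an element then does not depend on its expression. *)
Lemma adjoin_partial_derivation z w :
  (forall f g, coefs_in G f g -> f.[z] = 0 -> g.[z] + f^`().[z] * w = 0) ->
  [/\ partial_derivation (adjoin G z w), (G `<=` adjoin G z w)%classic &
      adjoin G z w (z, w)].
Proof.
move=> Gz0; split; last 2 first.
- move=> [x x'] Gx; exists x%:P, x'%:P; split; first exact: coefs_inC.
  by rewrite derivC !hornerC mul0r addr0.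
- exists 'X, 0; split; first by have := coefs_inXn 1; rewrite expr1.
  by rewrite derivX !hornerE.
split.
- exists 1, 0; split; first by have := coefs_inXn 0; rewrite expr0.
  by rewrite derivC !hornerE ?mul0r.
- move=> _ _ _ _ [f [g [Gf [-> ->]]]] [f1 [g1 [Gf1 [-> ->]]]].
  exists (f - f1), (g - g1); split; first exact: coefs_inB.
  by rewrite derivB !hornerE; congr (_, _); ring.
- move=> _ _ _ _ [f [g [Gf [-> ->]]]] [f1 [g1 [Gf1 [-> ->]]]].
  exists (f * f1), (g * f1 + f * g1); split; first exact: coefs_inM.
  by rewrite derivM !hornerE; congr (_, _); ring.
- by move=> _ [f [g [Gf [f0 ->]]]]; exact: Gz0.
Qed.

(* For [z] algebraic over the domain of [G], differentiating a relation
   [f.[z] = 0] of least degree determines [w]. *)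
Lemma pd_extension z : exists w,
  forall f g, coefs_in G f g -> f.[z] = 0 -> g.[z] + f^`().[z] * w = 0.
Proof.
have fun0 f g : coefs_in G f g -> f = 0 -> g = 0.
  move=> Gf f0; apply/polyP => i; rewrite coef0.
  by case: pdG => _ _ _; apply; have := Gf i; rewrite f0 coef0.
pose rel n := `[< exists f g,
  [/\ coefs_in G f g, f.[z] = 0, f != 0 & size f = n] >].
have [[n0 reln0]|norel] := pselect (exists n, rel n); last first.
  (* Here [z] satisfies no nontrivial relation, so any value of [w] would do. *)
  exists 0 => f g Gf fz; have [f0|f0] := eqVneq f 0.
    by rewrite (fun0 _ _ Gf f0) f0 derivC !hornerC mul0r addr0.
  by case: norel; exists (size f); apply/asboolP; exists f, g.
have [n /asboolP[p [q [Gp pz p0 sp]]] minn] := ex_minnP (ex_intro _ n0 reln0).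
have small f g : coefs_in G f g -> f.[z] = 0 -> (size f < size p)%N -> f = 0.
  move=> Gf fz; apply: contraTeq => f0; rewrite -leqNgt sp minn //.
  by apply/asboolP; exists f, g.
have sp1 : (1 < size p)%N.
  rewrite ltnNge; apply/negP => /size1_polyC pE.
  by move: pz p0; rewrite pE hornerC => ->; rewrite eqxx.
(* Otherwise the derivative of [p] would be a shorter relation, hence zero, which is impossible for
   nonconstant [p] in characteristic 0. *)
have dpz : p^`().[z] != 0.
  apply/eqP => /(small _ _ (coefs_in_deriv Gp)) => /(_ (lt_size_deriv p0)).
  move/(congr1 (fun f : {poly F} => f`_(size p).-2)) => /eqP.
  rewrite coef_deriv coef0 prednK -?subn1 ?subn_gt0 // subn1 mulrn_eq0.
  by rewrite -lead_coefE lead_coef_eq0 (negPf p0) orbF -leqn0; lia.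
exists (- q.[z] / p^`().[z]) => f g.
have [m] := ubnP (size f); elim: m f g => // m IHm f g szf Gf fz.
have [lt_fp|le_pf] := ltnP (size f) (size p).
  have f0 := small _ _ Gf fz lt_fp.
  by rewrite (fun0 _ _ Gf f0) f0 derivC !hornerC mul0r addr0.
pose d := (size f - size p)%N.
(* One step of pseudo-division, since the domain of [G] need not be closed under inverses. [g1] is
   the coefficientwise derivative of [f1], in the shape given by [coefs_inM]. *)
pose f1 := (lead_coef p)%:P * f - (lead_coef f)%:P * ('X^d * p).
pose g1 := (q`_(size p).-1)%:P * f + (lead_coef p)%:P * g -
  ((g`_(size f).-1)%:P * ('X^d * p) + (lead_coef f)%:P * (0 * p + 'X^d * q)).
have Gf1 : coefs_in G f1 g1.
  apply: coefs_inB; apply: coefs_inM => //; first exact: coefs_inC (Gp _).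
    exact: coefs_inC (Gf _).
  exact: coefs_inM (coefs_inXn _) Gp.
have f1z : f1.[z] = 0 by rewrite hornerD hornerN !hornerM fz pz !mulr0 subr0.
have f0 : f != 0.
  by rewrite -size_poly_gt0 (leq_trans _ le_pf) // (leq_trans _ sp1).
have szf1 : (size f1 < size f)%N.
  have sz_f : (0 < size f)%N by rewrite size_poly_gt0.
  rewrite -(prednK sz_f) ltnS; apply/leq_sizeP => j le_fj.
  rewrite coefB !coefCM coefXnM.
  have [lt_jd|le_dj] := ltnP j d.
    exfalso; move: lt_jd le_fj sp1 le_pf; rewrite /d.
    by move: (size f) (size p) => a b; clear; lia.
  move: le_fj; rewrite leq_eqVlt => /predU1P[<-|lt_fj].
    have -> : ((size f).-1 - d = (size p).-1)%N by rewrite /d; lia.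
    by rewrite -!lead_coefE mulrC subrr.
  have le_f : (size f <= j)%N by rewrite -(prednK sz_f).
  have le_p : (size p <= j - d)%N.
    by rewrite leq_subRL // addnC subnKC.
  by rewrite nth_default // [p`_(j - d)]nth_default // !mulr0 subr0.
have := IHm _ _ (leq_trans szf1 szf) Gf1 f1z.
rewrite /f1 /g1 !(derivB, derivM, derivC) !(hornerD, hornerN, hornerM, hornerC).
rewrite fz pz => E.
(* The contribution of ['X^d * p] vanishes by the choice of [w]. *)
have : lead_coef p * (g.[z] + f^`().[z] * (- q.[z] / p^`().[z])) = 0.
  rewrite -[RHS]E; field; exact: dpz.
by move/eqP; rewrite mulf_eq0 lead_coef_eq0 (negPf p0) => /eqP.
Qed.

End Extension.
End PartialDerivations.

Definition derivation (F : fieldType) (D : F -> F) : Prop :=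
  (forall x y, D (x - y) = D x - D y) /\
  (forall x y, D (x * y) = D x * y + x * D y).

Section Derivations.
Variables (F : fieldType) (D : F -> F).
Hypothesis derD : derivation D.

Lemma derivationB x y : D (x - y) = D x - D y. Proof. by case: derD. Qed.

Lemma derivationM x y : D (x * y) = D x * y + x * D y. Proof. by case: derD. Qed.

Lemma derivation0 : D 0 = 0. Proof. by have := derivationB 0 0; rewrite !subrr. Qed.

Lemma derivation1 : D 1 = 0.
Proof.
have := derivationM 1 1; rewrite mul1r mulr1 => /esym/eqP.
by rewrite mul1r -subr_eq0 addrK => /eqP.
Qed.

Lemma derivationN x : D (- x) = - D x.
Proof. by rewrite -sub0r derivationB derivation0 sub0r. Qed.

Lemma derivationD x y : D (x + y) = D x + D y.
Proof. by rewrite -[y]opprK derivationB !derivationN opprK. Qed.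

Lemma derivation_sum I (r : seq I) (P : pred I) (f : I -> F) :
  D (\sum_(i <- r | P i) f i) = \sum_(i <- r | P i) D (f i).
Proof. by apply: (big_morph D derivationD derivation0). Qed.

Lemma derivationXS x n : D (x ^+ n.+1) = n.+1%:R * x ^+ n * D x.
Proof.
elim: n => [|n IHn]; first by rewrite !expr1 expr0 !mul1r.
by rewrite exprSr derivationM IHn [n.+2%:R]mulrSr exprSr; ring.
Qed.

Lemma derivationV_eq0 x : x != 0 -> D x = 0 -> D x^-1 = 0.
Proof.
move=> x0 Dx; have := derivationM x x^-1; rewrite mulfV // derivation1 Dx mul0r add0r.
by move/esym/eqP; rewrite mulf_eq0 (negPf x0) => /eqP.
Qed.

Lemma derivation_nat n : D n%:R = 0.
Proof.
elim: n => [|n IHn]; first exact: derivation0.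
by rewrite mulrSr derivationD IHn derivation1 addr0.
Qed.

Lemma derivation_horner (p : {poly F}) x : (forall i, D p`_i = 0) ->
  D p.[x] = p^`().[x] * D x.
Proof.
elim/poly_ind: p => [|p c IHp] Dp; first by rewrite deriv0 !horner0 derivation0 mul0r.
have Dc : D c = 0 by have := Dp 0%N; rewrite coefD coefMX coefC add0r.
have Dp' i : D p`_i = 0.
  by have := Dp i.+1; rewrite coefD coefMX coefC addr0.
rewrite derivD derivM derivX derivC !(hornerD, hornerM, hornerX, hornerC).
by rewrite derivationD derivationM IHp // Dc; ring.
Qed.

End Derivations.

Section AlgebraicDerivations.
Variable F : numFieldType.

Lemma derivation_ratr (D : F -> F) q : derivation D -> D (ratr q) = 0.
Proof.
move=> derD; have Dint (m : int) : D m%:~R = 0.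
  by case: m => n; rewrite ?NegzE ?mulrNz ?derivationN // derivation_nat ?oppr0.
rewrite /ratr derivationM // Dint mul0r add0r derivationV_eq0 ?mulr0 //.
by rewrite intr_eq0 denq_neq0.
Qed.

(** Applying [D] to [p(x) = 0] gives [p'(x) * D x = 0]. If [p'(x) = 0], the smaller polynomial [p']
    replaces [p]. *)
Lemma algebraic_derivation0 (D : F -> F) x :
  derivation D -> algebraicOver (@ratr F) x -> D x = 0.
Proof.
move=> derD [p p0 /eqP px]; have [n] := ubnP (size p).
elim: n p p0 px => // n IHn p p0 px; rewrite ltnS => szp.
have [dpx|dpx] := eqVneq (map_poly ratr p)^`().[x] 0.
  move: dpx; rewrite deriv_map => dpx.
  apply: (IHn p^`()) => //; last exact: leq_trans (lt_size_deriv p0) szp.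
  apply/eqP => dp0; case/eqP: (p0).
  have : (size p <= 1)%N.
    rewrite leqNgt; apply/negP => sp1.
    move: dp0 => /(congr1 (fun f : {poly rat} => f`_(size p).-2)) /eqP.
    rewrite coef_deriv coef0 prednK -?subn1 ?subn_gt0 // subn1 mulrn_eq0.
    rewrite -lead_coefE lead_coef_eq0 (negPf p0) orbF.
    by move: (size p) sp1 => [|[]].
  move=> /size1_polyC; move: px => /[swap] pE; rewrite pE map_polyC hornerC.
  by move=> /eqP; rewrite fmorph_eq0 => /eqP ->.
have := derivation_horner derD x (p := map_poly ratr p).
rewrite px derivation0 // => /(_ _)/esym/eqP; rewrite mulf_eq0 (negPf dpx) => E.
by apply/eqP/E => i; rewrite coef_map /= derivation_ratr.
Qed.

(** The zero derivation of the rationals extends by [x |-> 1]. Zorn's lemma gives a maximal further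
    extension, which is total by [pd_extension]. *)
Lemma transcendental_derivation (x : F) : ~ algebraicOver (@ratr F) x ->
  exists D : F -> F, derivation D /\ D x = 1.
Proof.
move=> trx.
pose Q := [set u : F * F | exists q, u = (ratr q, 0)]%classic.
have pdQ : partial_derivation Q.
  split.
  - by exists 1; rewrite rmorph1.
  - move=> _ _ _ _ [q [-> ->]] [r [-> ->]].
    by exists (q - r); rewrite rmorphB subr0.
  - move=> _ _ _ _ [q [-> ->]] [r [-> ->]].
    by exists (q * r); rewrite rmorphM mulr0 mul0r addr0.
  - by move=> x' [q []].
have [] := @adjoin_partial_derivation _ _ pdQ x 1.
  move=> f g Qf fx.
  have g0 : g = 0 by apply/polyP => i; have [q [_ ->]] := Qf i; rewrite coef0.
  suff -> : f = 0 by rewrite g0 derivC !hornerC mul0r addr0.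
  pose p := \poly_(i < size f) xget 0 [set q | f`_i = ratr q]%classic.
  have fE : map_poly ratr p = f.
    apply/polyP => i; rewrite coef_map coef_poly /=.
    case: ltnP => [_|le_fi]; last by rewrite rmorph0 nth_default.
    case: xgetP => [q _ /= -> //|noq].
    by have [q [fq _]] := Qf i; case: (noq q).
  apply/eqP; case: (eqVneq f 0) => // f0; case: trx; exists p.
    by apply: contraNneq f0 => p0; rewrite -fE p0 rmorph0.
  by rewrite fE; apply/eqP.
set G0 := adjoin _ _ _ => pdG0 _ G0x.
(* The nonemptiness guard lets the union of the empty chain satisfy [P]. A maximal [G] is nonempty,
   since otherwise [G0] would be larger. *)
pose P (G : set (F * F)) := (G !=set0 -> partial_derivation G /\ G (x, 1))%classic.
have [|G [PG maxG]] := @Zorn_bigcup _ P.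
  move=> C PC totC [u [X CX Xu]].
  have PX Y u1 : C Y -> Y u1 -> partial_derivation Y /\ Y (x, 1).
    by move=> CY Yu1; apply: PC => //; exists u1.
  have common u1 u2 : (\bigcup_(Y in C) Y)%classic u1 ->
      (\bigcup_(Y in C) Y)%classic u2 -> exists Y, [/\ C Y, Y u1 & Y u2].
    move=> [Y CY Yu1] [Y' CY' Yu2]; have [YY'|Y'Y] := totC _ _ CY CY'.
      by exists Y'; split=> //; exact: YY'.
    by exists Y; split=> //; exact: Y'Y.
  have [pdX Xx] := PX _ _ CX Xu; split; last by exists X.
  split.
  - by exists X => //; case: pdX.
  - move=> y y' t t' /common/[apply] -[Y [CY Yy Yt]].
    by exists Y => //; apply: pdB => //; case: (PX _ _ CY Yy).
  - move=> y y' t t' /common/[apply] -[Y [CY Yy Yt]].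
    by exists Y => //; apply: pdM => //; case: (PX _ _ CY Yy).
  - by move=> y' [Y CY Yy]; case: (PX _ _ CY Yy) => -[_ _ _ Y0] _; exact: Y0.
have [pdG Gx] : partial_derivation G /\ G (x, 1).
  apply: PG; apply: contrapT => /set0P/negP; rewrite negbK => /eqP G0E.
  apply: (maxG G0); last by [].
  by rewrite G0E; split=> // /(_ _ G0x).
have total z : exists w, G (z, w).
  have [w Gw] := pd_extension pdG z.
  have [pdG' subG' G'z] := adjoin_partial_derivation pdG Gw.
  exists w; apply: contrapT => nGz; apply: (maxG (adjoin G z w)).
    by split=> // /(_ _ G'z).
  by split=> //; exact: subG'.
have functional z w w' : G (z, w) -> G (z, w') -> w = w'.
  move=> Gw Gw'; apply/eqP; rewrite -subr_eq0; apply/eqP.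
  by case: (pdG) => _ GB _; apply; rewrite -(subrr z); exact: GB.
have [D GD] := choice total.
exists D; split; last exact: functional (GD x) Gx.
split=> y t; apply: functional (GD _) _; first exact: pdB.
exact: pdM.
Qed.

Lemma algebraic_derivationP (x : F) : algebraicOver (@ratr F) x <->
  forall D : F -> F, derivation D -> D x = 0.
Proof.
split=> [algx D derD|Dx]; first exact: algebraic_derivation0.
apply: contrapT => /transcendental_derivation[D [derD D1]].
by have /eqP := Dx D derD; rewrite D1 oner_eq0.
Qed.

End AlgebraicDerivations.

(** * Derivations of the plane *)

Section PlaneAlgebra.
Variable R : realType.
Implicit Types z w : R[i].

Lemma complexP z w :
  complex.Re z = complex.Re w -> complex.Im z = complex.Im w -> z = w.
Proof. by case: z w => x y [x' y'] /= -> ->. Qed.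

Lemma crossDr z w w' : cross z (w + w') = cross z w + cross z w'.
Proof. by case: z w w' => ? ? [? ?] [? ?]; rewrite /cross /=; ring. Qed.

Lemma crossZl x z w : cross (x%:C * z) w = x * cross z w.
Proof. by case: z w => ? ? [? ?]; rewrite /cross /=; ring. Qed.

Lemma crossZr x z w : cross z (x%:C * w) = x * cross z w.
Proof. by case: z w => ? ? [? ?]; rewrite /cross /=; ring. Qed.

Lemma crossNr z w : cross z (- w) = - cross z w.
Proof. by case: z w => ? ? [? ?]; rewrite /cross /=; ring. Qed.

Lemma crosszz z : cross z z = 0.
Proof. by case: z => ? ?; rewrite /cross /=; ring. Qed.

Lemma dot0l w : dot 0 w = 0.
Proof. by rewrite /dot !mul0r addr0. Qed.

Lemma dotDl z z' w : dot (z + z') w = dot z w + dot z' w.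
Proof. by case: z z' w => ? ? [? ?] [? ?]; rewrite /dot /=; ring. Qed.

Lemma dotZl x z w : dot (x%:C * z) w = x * dot z w.
Proof. by case: z w => ? ? [? ?]; rewrite /dot /=; ring. Qed.

Lemma dot_rotl t z w : dot ((0 +i* t) * z) w = t * cross z w.
Proof. by case: z w => ? ? [? ?]; rewrite /dot /cross /=; ring. Qed.

Lemma normc_real z : `|z| = (complex.Re `|z|)%:C.
Proof. by rewrite normc_def. Qed.

Lemma sqr_Re_normc z : complex.Re `|z| ^+ 2 = dot z z.
Proof.
by rewrite normc_def /= sqr_sqrtr ?addr_ge0 ?sqr_ge0 // /dot !expr2.
Qed.

Lemma dot_gt0 z : z != 0 -> 0 < dot z z.
Proof.
move=> z0; rewrite -sqr_Re_normc lt0r sqrf_eq0 sqr_ge0 andbT.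
by apply: contraNneq z0 => n0; rewrite -normr_eq0 normc_real n0.
Qed.

Lemma norm1_dot w : `|w| = 1 -> dot w w = 1.
Proof. by move=> w1; rewrite -sqr_Re_normc w1 expr1n. Qed.

Lemma similar_edge N (P Q : 'I_N -> R[i]) c d k :
  (forall k, Q k = c * P k + d) -> edge Q k = c * edge P k.
Proof. by move=> QE; rewrite /edge !QE; ring. Qed.

End PlaneAlgebra.

Lemma cyclic_const N (T : Type) (F : 'I_N -> T) :
  (forall k, F (ordS k) = F k) -> forall k l, F k = F l.
Proof.
move=> FS; suff F0 (k0 : 'I_N) : k0 = 0%N :> nat -> forall k, F k = F k0.
  move=> k l; have N0 : (0 < N)%N by apply: leq_ltn_trans (ltn_ord k).
  by rewrite (F0 (Ordinal N0)) // [RHS](F0 (Ordinal N0)).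
move=> k00 [n]; elim: n => [|n IHn] ltn; first by congr F; apply: val_inj.
rewrite -(IHn (ltnW ltn)) -[RHS]FS; congr F; apply: val_inj.
by rewrite /= modn_small.
Qed.

Section ComplexDerivation.
Variables (R : realType) (D : R -> R).
Hypothesis derD : derivation D.
Implicit Types z w : R[i].

(** The extension of [D] to a derivation of [R[i]] that kills the imaginary unit. *)
Definition cder z : R[i] := D (complex.Re z) +i* D (complex.Im z).

Lemma derivation_cder : derivation cder.
Proof.
split=> -[x y] [x' y']; apply: complexP => /=; rewrite ?(derivationB derD) //.
  by rewrite !(derivationM derD); ring.
by rewrite (derivationD derD) !(derivationM derD); ring.
Qed.
Let derC := derivation_cder.

Lemma cder_real x : cder x%:C = (D x)%:C.
Proof. by apply: complexP; rewrite /= ?(derivation0 derD). Qed.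

Lemma cderZ x z : cder (x%:C * z) = (D x)%:C * z + x%:C * cder z.
Proof. by rewrite (derivationM derC) cder_real. Qed.

Lemma derivation_cross z w : D (cross z w) = cross (cder z) w + cross z (cder w).
Proof. by rewrite /cross (derivationB derD) !(derivationM derD) /=; ring. Qed.

Lemma derivation_dot z w : D (dot z w) = dot (cder z) w + dot z (cder w).
Proof. by rewrite /dot (derivationD derD) !(derivationM derD) /=; ring. Qed.

Lemma algebraic_point_cder z : algebraic_point z -> cder z = 0.
Proof. by case=> zr zi; apply: complexP; apply: algebraic_derivation0. Qed.

(** Differentiating [omega ^+ N = 1] shows that [omega] is constant. *)
Lemma cder_omegaX N k : (0 < N)%N -> cder (omega R N ^+ k) = 0.
Proof.
case: N => // n _; have := derivationXS derC (omega R n.+1) n.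
rewrite omegaXN // (derivation1 derC) => /esym/eqP; rewrite !mulf_eq0 pnatr_eq0 /=.
have w0 : omega R n.+1 != 0.
  have := oner_neq0 R[i]; apply: contraNneq => w0.
  by rewrite -(@omegaXN R n.+1) // w0 expr0n.
rewrite expf_eq0 (negPf w0) andbF /= => /eqP Dw.
by case: k => [|k]; rewrite ?(derivation1 derC) ?(derivationXS derC) ?Dw ?mulr0.
Qed.

Lemma cder_side_direction N (k : 'I_N) : cder (side_direction R k) = 0.
Proof. by apply: cder_omegaX; apply: leq_ltn_trans (ltn_ord k). Qed.

Lemma cder_side_normal N (k : 'I_N) : cder (side_normal R k) = 0.
Proof.
rewrite /side_normal (derivationM derC) -[omega R N ^+ k]/(side_direction R k).
rewrite cder_side_direction mulr0 addr0 /cder /= (derivationN derD).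
rewrite (derivation1 derD) (derivation0 derD).
by rewrite oppr0 mul0r.
Qed.

Lemma derivation_cos_sin N : (0 < N)%N ->
  D (cos (angle_step R N)) = 0 /\ D (sin (angle_step R N)) = 0.
Proof. by move=> N0; have := cder_omegaX 1 N0; rewrite expr1 => -[]. Qed.

Lemma cder_norm z : cder z = 0 -> cder `|z| = 0.
Proof.
move=> Dz; have [->|z0] := eqVneq z 0; first by rewrite normr0 (derivation0 derC).
have n0 : complex.Re `|z| != 0.
  apply: contraNneq z0 => n0.
  by rewrite -normr_eq0 normc_real n0.
rewrite normc_real cder_real; suff -> : D (complex.Re `|z|) = 0 by [].
have /eqP := congr1 D (sqr_Re_normc z).
rewrite (derivation_dot z z) Dz dot0l add0r (derivationXS derD) expr1.
have -> : dot z 0 = 0 by rewrite /dot !mulr0 addr0.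
by rewrite !mulf_eq0 pnatr_eq0 (negPf n0) => /eqP.
Qed.

(** The derivative of a unit vector is orthogonal to it, so it is a real multiple of [i * w]; that
    multiple is the angular velocity. *)
Lemma cder_unit w : dot w w = 1 -> cder w = (0 +i* cross w (cder w)) * w.
Proof.
move=> w1; have := congr1 D w1; rewrite derivation_dot (derivation1 derD) => w1'.
have {w1'} w1' : dot w (cder w) = 0.
  move: w1'; rewrite /dot ![complex.Re (cder w) * _]mulrC.
  rewrite ![complex.Im (cder w) * _]mulrC -mulr2n => /eqP.
  by rewrite mulrn_eq0 => /eqP.
move: w1 w1'; rewrite /cder; case: w => x y; rewrite /dot /cross /=.
move: (D x) (D y) => x' y' w1 w1'; apply: complexP => /=.
  transitivity (x' * (x * x + y * y)); first by rewrite w1 mulr1.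
  transitivity (x * (x * x' + y * y') - (x * y' - y * x') * y); first by ring.
  by rewrite w1'; ring.
transitivity (y' * (x * x + y * y)); first by rewrite w1 mulr1.
transitivity (y * (x * x' + y * y') + (x * y' - y * x') * x); first by ring.
by rewrite w1'; ring.
Qed.

End ComplexDerivation.

(** * Dual pairs of polygons *)

Section DualPolygons.
Variables (R : realType) (N : nat) (N2 : (2 < N)%N).
Implicit Types w a b : 'I_N -> R[i].

Local Notation dir := (@side_direction R N).

Lemma cross_side_direction k : cross (dir k) (dir (ordS k)) = sin (angle_step R N).
Proof.
rewrite /side_direction omegaS omegaX /omega /cross /=.
have := cos2Dsin2 (angle_step R N * (k : nat)%:R).
set c := cos (_ * _); set s := sin (_ * _) => cs.
by rewrite -[RHS]mulr1 -cs; ring.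
Qed.

Lemma on_raysE (d z : 'I_N -> R[i]) : (forall k, on_ray (d k) (z k)) ->
  exists t : 'I_N -> R, forall k, 0 < t k /\ z k = (t k)%:C * d k.
Proof.
move=> dz; have /choice[t tP] k : exists t : R, 0 < t /\ z k = t%:C * d k.
  by have [t t0 zE] := dz k; exists t.
by exists t.
Qed.

Section Dual.
Variables w a : 'I_N -> R[i].
Hypothesis a_ray : forall k, on_ray (dir k) (a k).
Hypothesis a_edge : forall k, on_ray (- w k) (a (ordS k) - a k).

(** The triangle 0, [a k], [a (ordS k)] has positive signed area, because consecutive rays make an
    angle less than pi. Its third side is a negative multiple of [w k], so the area can be computed
    from either endpoint of that side. *)
Lemma dual_cross_gt0 k :
  0 < cross (w k) (dir k) /\ 0 < cross (w k) (dir (ordS k)).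
Proof.
have [s s0 aE] := a_ray k; have [s' s'0 aE'] := a_ray (ordS k).
have [p p0 /eqP] := a_edge k; rewrite subr_eq => /eqP pE.
have c0 : 0 < s * s' * sin (angle_step R N).
  by rewrite !mulr_gt0 // sin_angle_step_gt0.
have aa : cross (a k) (a (ordS k)) = s * s' * sin (angle_step R N).
  by rewrite aE aE' crossZl crossZr cross_side_direction mulrA.
have c1 : s * s' * sin (angle_step R N) = p * s * cross (w k) (dir k).
  rewrite -aa pE crossDr crosszz addr0 crossZr crossNr aE crossZl.
  by rewrite /cross; ring.
have c2 : s * s' * sin (angle_step R N) = p * s' * cross (w k) (dir (ordS k)).
  have aE2 : a k = a (ordS k) + p%:C * w k by rewrite pE; ring.
  have -> : p * s' * cross (w k) (dir (ordS k)) =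
      p * cross (w k) (a (ordS k)) by rewrite aE' crossZr mulrA.
  rewrite -aa aE2; case: (a (ordS k)) (w k) => ? ? [? ?].
  by rewrite /cross /=; ring.
by split; [move: c0; rewrite c1 | move: c0; rewrite c2];
  rewrite pmulr_rgt0 ?mulr_gt0.
Qed.

Variable D : R -> R.
Hypothesis derD : derivation D.

(* If [w] rotates with angular velocity [tau], then the logarithmic derivatives
   of the radii of [a] increase around the polygon by [- tau] times positive
   quantities, so cyclicity forces [tau = 0]. *)
Lemma dual_rigid tau : (forall k, cder D (w k) = (0 +i* tau) * w k) -> tau = 0.
Proof.
move=> Dw; have [s sP] := on_raysE a_ray.
pose X k := cross (w k) (dir (ordS k)); pose Y k := cross (w k) (dir k).
have X0 k : 0 < X k by case: (dual_cross_gt0 k).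
have Y0 k : 0 < Y k by case: (dual_cross_gt0 k).
(* Both ends of an edge parallel to [w k] have the same cross product with [w k]. *)
have sXY k : s (ordS k) * X k = s k * Y k.
  apply/eqP; rewrite -subr_eq0 -!crossZr -(sP (ordS k)).2 -(sP k).2.
  rewrite -crossNr -?crossDr; have [p _ ->] := a_edge k.
  by rewrite crossZr crossNr crosszz oppr0 mulr0.
have Dcross k l : D (cross (w k) (dir l)) = - tau * dot (w k) (dir l).
  rewrite (derivation_cross derD) Dw cder_side_direction //.
  by case: (w k) (dir l) => ? ? [? ?]; rewrite /cross /dot /=; ring.
(* The logarithmic derivative of [Y k / X k] is [- tau * c k], by the identity [K] below. *)
pose c k := dot (w k) (w k) * sin (angle_step R N) / (X k * Y k).
have c0 k : 0 < c k.
  rewrite divr_gt0 ?mulr_gt0 ?sin_angle_step_gt0 //.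
  apply: dot_gt0; apply: contraTneq (X0 k) => wk0.
  by rewrite /X wk0 /cross /= !mul0r subrr ltxx.
have logS k : D (s (ordS k)) / s (ordS k) = D (s k) / s k - tau * c k.
  have := congr1 D (sXY k); rewrite !(derivationM derD) !Dcross => E.
  have s0 := lt0r_neq0 (sP k).1; have s'0 := lt0r_neq0 (sP (ordS k)).1.
  have x0 := lt0r_neq0 (X0 k); have y0 := lt0r_neq0 (Y0 k).
  have K : Y k * dot (w k) (dir (ordS k)) - X k * dot (w k) (dir k) =
      - (dot (w k) (w k) * sin (angle_step R N)).
    rewrite -(cross_side_direction k) /X /Y.
    case: (w k) (dir k) (dir (ordS k)) => ? ? [? ?] [? ?].
    by rewrite /cross /dot /=; ring.
  rewrite /c -[_ * sin _]opprK -K.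
  have -> : D (s (ordS k)) =
      (D (s k) * Y k - s k * tau * dot (w k) (dir k)
       + s (ordS k) * tau * dot (w k) (dir (ordS k))) / X k.
    apply: (mulIf x0); rewrite divfK //; move: E; set U := D _ * X k.
    move=> /(canRL (addrK _)) ->; ring.
  have -> : s (ordS k) = s k * Y k / X k by rewrite -sXY mulfK.
  by field; rewrite s0 x0 y0.
have := sum_ordS (fun k => D (s k) / s k); under eq_bigr => k _ do rewrite logS.
rewrite sumrB => /eqP; rewrite -subr_eq0 addrAC subrr add0r oppr_eq0 -mulr_sumr.
rewrite mulf_eq0 => /orP[/eqP //|].
have N0 : (0 < N)%N by apply: leq_trans N2.
rewrite psumr_eq0 => [/allP/(_ (Ordinal N0))|k _]; last exact: ltW.
by rewrite mem_index_enum /= => /(_ isT); rewrite gt_eqF.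
Qed.

(** As the edges of [b] are parallel to the side directions, the ratios of consecutive radii are
    quotients of cross products of constant vectors. All radii therefore share one logarithmic
    derivative. *)
Lemma dual_homothety b :
  (forall k, on_ray (w k) (b k)) ->
  (forall k, on_ray (dir k) (b k - b (ord_pred k))) ->
  (forall k, cder D (w k) = 0) ->
  exists rho : R, forall k, cder D (b k) = rho%:C * b k.
Proof.
move=> b_ray b_edge Dw; have [r rP] := on_raysE b_ray.
pose X k := cross (w k) (dir (ordS k)); pose Y k := cross (w k) (dir k).
have X0 k : X k != 0 by case: (dual_cross_gt0 k) => _ /lt0r_neq0.
have Y0 k : Y k != 0 by case: (dual_cross_gt0 k) => /lt0r_neq0.
have rXY k : r (ordS k) * Y (ordS k) = r k * X k.
  apply/eqP; rewrite -subr_eq0 -!crossZl -(rP (ordS k)).2 -(rP k).2.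
  have -> : cross (b (ordS k)) (dir (ordS k)) - cross (b k) (dir (ordS k)) =
      cross (b (ordS k) - b k) (dir (ordS k)).
    by case: (b (ordS k)) (b k) => ? ? [? ?]; rewrite /cross /=; ring.
  have := b_edge (ordS k); rewrite ordSK => -[q _ ->].
  by rewrite crossZl crosszz mulr0.
have Dcross k l : D (cross (w k) (dir l)) = 0.
  by rewrite (derivation_cross derD) Dw cder_side_direction // /cross /= ?mul0r ?mulr0; ring.
have logS k : D (r (ordS k)) / r (ordS k) = D (r k) / r k.
  have := congr1 D (rXY k); rewrite !(derivationM derD) !Dcross !mulr0 !addr0 => E.
  have r0 := lt0r_neq0 (rP k).1; have r'0 := lt0r_neq0 (rP (ordS k)).1.
  apply: (mulIf (mulf_neq0 r'0 (Y0 (ordS k)))).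
  by rewrite mulrA divfK // E rXY mulrA divfK.
have N0 : (0 < N)%N by apply: leq_trans N2.
exists (D (r (Ordinal N0)) / r (Ordinal N0)) => k.
rewrite (cyclic_const logS (Ordinal N0) k) (rP k).2 (cderZ derD) Dw mulr0 addr0.
by rewrite mulrA -rmorphM divfK // lt0r_neq0 // (rP k).1.
Qed.

End Dual.

(* Pairing [\sum_k cder (w k) = 0] with [e] gives a vanishing sum of the
   nonnegative terms [cross (w k) e ^+ 2 / r k]: this is the strict convexity
   of the sum of the distances to the vertices [b k], of which the origin is a
   critical point. *)
Lemma balanced_rigid (D : R -> R) w b (kappa : R) (e : R[i]) : derivation D ->
  (forall k, dot (w k) (w k) = 1) -> \sum_k w k = 0 ->
  (forall k, on_ray (w k) (b k)) ->
  (forall k, cder D (b k) = kappa%:C * b k + e) ->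
  forall k, cder D (w k) = 0.
Proof.
move=> derD w1 sumw b_ray Db; have [r rP] := on_raysE b_ray.
have derC := derivation_cder derD.
(* Taking the cross product of [Db] with [w k] removes the radial terms, so only [e] turns the
   ray. *)
have tauE k : cross (w k) (cder D (w k)) = cross (w k) e / r k.
  apply: (mulfI (lt0r_neq0 (rP k).1)); rewrite mulrC [RHS]mulrC.
  rewrite divfK ?lt0r_neq0 ?(rP k).1 // mulrC.
  have := congr1 (cross (w k)) (Db k).
  by rewrite (rP k).2 (cderZ derD) !crossDr !crossZr crosszz !mulr0 !add0r.
have Dw k := cder_unit derD (w1 k).
have dotE k : dot (cder D (w k)) e = cross (w k) e ^+ 2 / r k.
  by rewrite Dw tauE dot_rotl mulrAC expr2.
have : \sum_k cross (w k) e ^+ 2 / r k = 0.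
  under eq_bigr => k _ do rewrite -dotE.
  rewrite -(big_morph (fun z => dot z e) (fun x y => dotDl x y e) (dot0l e)).
  by rewrite -(derivation_sum derC) sumw (derivation0 derC) dot0l.
move/eqP; rewrite psumr_eq0 => [/allP sum0 k|k _]; last first.
  by rewrite divr_ge0 ?sqr_ge0 // ltW // (rP k).1.
have := sum0 k; rewrite mem_index_enum /= => /(_ isT).
rewrite mulf_eq0 sqrf_eq0 invr_eq0 (gt_eqF (rP k).1) orbF => /eqP c0.
by rewrite Dw tauE c0 mul0r mul0r.
Qed.

End DualPolygons.

(** * Derivations acting on heights, vertices and areas *)

Section EquiangularDerivation.
Variables (R : realType) (N : nat).
Implicit Types (P Q b : 'I_N -> R[i]) (h : 'rV[R]_N).

Lemma signed_area_scale P (c : R) :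
  signed_area (fun k => c%:C * P k) = c ^+ 2 * signed_area P.
Proof.
rewrite /signed_area mulrA mulr_sumr; congr (_ / 2); apply: eq_bigr => k _.
by rewrite crossZl crossZr mulrA expr2.
Qed.

Lemma heights_similar P (c : R) d :
  heights (fun k => c%:C * P k + d) = c *: heights P + translation N d.
Proof. by apply/rowP => k; rewrite !mxE dotDl dotZl. Qed.

(** The sides in direction [omega ^+ 0 = 1] are positive reals for both polygons, and [c] is their
    ratio. *)
Lemma normalized_similar P Q c d : (0 < N)%N -> normalized P -> normalized Q ->
  (forall k, Q k = c * P k + d) -> exists2 c0 : R, 0 < c0 & c = c0%:C.
Proof.
move=> N0 nP nQ QE; have [q q0 qE] := nP (Ordinal N0).
have [q' q'0 q'E] := nQ (Ordinal N0); exists (q' / q); first exact: divr_gt0.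
have qC0 : q%:C != 0 :> R[i] by rewrite fmorph_eq0 lt0r_neq0.
move: q'E; rewrite !QE opprD addrACA subrr addr0 -mulrBr qE mulrA.
rewrite /side_direction expr0 !mulr1 => cq.
by rewrite rmorphM fmorphV /= -cq mulfK.
Qed.

Variable D : R -> R.
Hypothesis derD : derivation D.
Let derC := derivation_cder derD.

Lemma derivation_signed_area P rho :
  (forall k, cder D (P k) = rho%:C * P k) ->
  D (signed_area P) = 2 * rho * signed_area P.
Proof.
move=> DP; rewrite /signed_area (derivationM derD) (derivation_sum derD).
rewrite (derivationV_eq0 derD) ?(derivation_nat derD) ?pnatr_eq0 // mulr0 addr0.
rewrite mulrA mulr_sumr; congr (_ / 2); apply: eq_bigr => k _.
by rewrite (derivation_cross derD) !DP crossZl crossZr; ring.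
Qed.

Lemma derivation_mulmx m n p (A : 'M[R]_(m, n)) (B : 'M[R]_(n, p)) :
  (forall i j, D (B i j) = 0) -> map_mx D (A *m B) = map_mx D A *m B.
Proof.
move=> DB; apply/matrixP => i j; rewrite !mxE (derivation_sum derD).
by apply: eq_bigr => k _; rewrite (derivationM derD) DB mulr0 addr0 mxE.
Qed.

Lemma derivation_heights P : map_mx D (heights P) = heights (cder D \o P).
Proof.
apply/rowP => k; rewrite !mxE (derivation_dot derD) (cder_side_normal derD).
by rewrite [X in _ + X](_ : _ = 0) ?addr0 // /dot !mulr0 addr0.
Qed.

(** Vertices are linear in [h] with coefficients built from roots of unity, which [D] kills. *)
Lemma cder_vertex h k : (2 < N)%N -> cder D (vertex h k) = vertex (map_mx D h) k.
Proof.
move=> N2; have [Dc Ds] := derivation_cos_sin derD (ltnW (ltnW N2)).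
have Dsi := derivationV_eq0 derD (lt0r_neq0 (sin_angle_step_gt0 R N2)) Ds.
rewrite /vertex (derivationD derC) !(cderZ derD) (cder_side_normal derD).
rewrite (cder_side_direction derD) !mulr0 !addr0 !mxE.
by rewrite (derivationM derD) Dsi mulr0 addr0 (derivationB derD)
  (derivationM derD) Dc mul0r add0r.
Qed.

End EquiangularDerivation.

(** * Algebraic polygons and algebraic hyperbolic points *)

Theorem theorem1p2 (R : realType) (N : nat) (hN : (5 <= N)%N)
  (Phi : 'M[R]_(N, N - 2)) (hPhi : algebraic_chart Phi)
  (L : 'I_N -> R[i]) (hLconv : strictly_convex L) (hLeq : equilateral L)
  (V : 'rV[R]_(N - 2)) (hV : point_of Phi L V) :
  (exists L' : 'I_N -> R[i], similar_polygon L L' /\ algebraic_polygon L') <->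
  algebraic_matrix V.
Proof.
have N2 : (2 < N)%N by apply: leq_trans hN.
have N0 : (0 < N)%N by apply: leq_trans hN.
pose k0 := Ordinal N0.
have [[area1 _] [b [P' [[_ [u [a [u1 _ rays a_edge b_edge]]]]]]]] := hV.
move=> [c [d [_ PE]]] nP VE.
have a_ray k := (rays k).1; have b_ray k := (rays k).2.
have [c0 c0_gt0 cE] := normalized_similar N0 b_edge nP PE.
have {}PE k : P' k = c0%:C * b k + d by rewrite PE cE.
pose w k := u * unit_edge L k.
have w_neq0 k : w k != 0.
  have [+ _] := dual_cross_gt0 N2 a_ray a_edge k; apply: contraTneq => wk0.
  by rewrite -/(w k) wk0 /cross /= !mul0r subrr ltxx.
have u_neq0 : u != 0 by rewrite -normr_eq0 u1 oner_neq0.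
pose l := `|edge L k0|; have lE k : `|edge L k| = l by exact: hLeq.
have edge_neq0 k : edge L k != 0.
  by apply: contraNneq (w_neq0 k) => e0; rewrite /w /unit_edge e0 mul0r mulr0.
have l_neq0 : l != 0 by rewrite /l normr_eq0.
(* As all sides have length [l], the [w k] are the edges of the single polygon [u / l * L], similar
   to [L]. *)
have wE k : w k = u / l * edge L k by rewrite /w /unit_edge lE; ring.
have w1 k : dot (w k) (w k) = 1.
  apply: norm1_dot; rewrite wE !normrM u1 mul1r normfV lE normr_id.
  by rewrite mulVf.
have Phi_algebraic D : derivation D -> forall i j, D (Phi i j) = 0.
  by move=> derD i j; apply: algebraic_derivation0 => //; apply: hPhi.1.
have chart_translation t : translation N t *m Phi = 0.
  by apply/hPhi.2; exists t.
have heightsP' : heights P' = c0 *: heights b + translation N d.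
  by rewrite -heights_similar; congr heights; apply/funext.
have VbE : V = c0 *: (heights b *m Phi).
  by rewrite VE heightsP' mulmxDl chart_translation addr0 scalemxAl.
have areaE : c0 ^+ 2 * signed_area b = 1.
  rewrite -area1 VE area_formE // -signed_area_scale -(signed_area_translate _ d).
  by congr signed_area; apply/funext => k; rewrite vertex_heights.
split=> [[L' [[c1 [d1 [c1_neq0 L'E]]] algL']] i j|algV].
  apply/algebraic_derivationP => D derD; have derC := derivation_cder derD.
  have DL' k : cder D (edge L' k) = 0.
    by rewrite (derivationB derC) !(algebraic_point_cder derD) ?subrr.
  have L'edge k : edge L' k = c1 * edge L k by exact: similar_edge L'E.
  have L'edge_neq0 k : edge L' k != 0 by rewrite L'edge mulf_neq0.
  have De k : cder D (unit_edge L' k) = 0.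
    rewrite /unit_edge (derivationM derC) DL' mul0r add0r.
    rewrite (derivationV_eq0 derC) ?mulr0 ?normr_eq0 //.
    exact: cder_norm.
  (* The unit edges of [L'] are those of [L] turned by [c1 / |c1|]; [v] undoes this turn and then
     applies [u]. The angular velocity of [v] is thus common to all [w k]. *)
  pose v := u * (`|c1| / c1).
  have v1 : dot v v = 1.
    apply: norm1_dot; rewrite !normrM u1 mul1r normfV normr_id mulfV //.
    by rewrite normr_eq0.
  have wvE k : w k = v * unit_edge L' k.
    rewrite /w /v /unit_edge L'edge normrM.
    have : `|c1| != 0 by rewrite normr_eq0.
    have : `|edge L k| != 0 by rewrite normr_eq0.
    by move: `|c1| `|edge L k| => x y y0 x0; field; rewrite c1_neq0 x0 y0.
  have Dw k : cder D (w k) = (0 +i* cross v (cder D v)) * w k.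
    by rewrite wvE (derivationM derC) De mulr0 addr0 {1}(cder_unit derD v1) mulrA.
  have tau0 := dual_rigid N2 a_ray a_edge derD Dw.
  have {}Dw k : cder D (w k) = 0 by rewrite Dw tau0 mul0r.
  have [rho Db] := dual_homothety N2 a_ray a_edge derD b_ray b_edge Dw.
  (* Differentiating the area-one condition: the growth rate of the scale [c0] cancels that of
     [b]. *)
  have c_rho : D c0 + c0 * rho = 0.
    have := congr1 D areaE; rewrite (derivationM derD) (derivationXS derD) expr1.
    rewrite (derivation_signed_area derD Db) (derivation1 derD) => E.
    have S0 : signed_area b != 0.
      apply/eqP => S0; have /eqP := areaE.
      by rewrite S0 mulr0 eq_sym oner_eq0.
    have cS0 : 2 * c0 * signed_area b != 0.
      by rewrite mulf_neq0 // mulf_neq0 ?pnatr_eq0 // lt0r_neq0.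
    apply: (mulfI cS0).
    by rewrite mulr0 -E; ring.
  have DH : map_mx D (heights b *m Phi) = rho *: (heights b *m Phi).
    rewrite (derivation_mulmx derD) ?(derivation_heights derD) ?scalemxAl //;
      last exact: Phi_algebraic.
    by congr (_ *m _); apply/rowP => k; rewrite !mxE /= Db dotZl.
  move/matrixP/(_ i j): DH; rewrite VbE !mxE (derivationM derD) => ->.
  by rewrite mulrA -mulrDl c_rho mul0r.
(* One vertex is placed at the origin, so constant edges [w k] make all vertices constant. *)
exists (fun k => u / l * (L k - L k0)); split.
  exists (u / l), (- (u / l * L k0)).
  by split=> [|k]; [rewrite mulf_neq0 ?invr_eq0 | rewrite mulrBr].
suff DL' D : derivation D -> forall k, cder D (u / l * (L k - L k0)) = 0.
  by move=> k; split; apply/algebraic_derivationP => D /DL'/(_ k)[].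
move=> derD; have derC := derivation_cder derD.
have DhPhi : map_mx D (heights P') *m Phi = 0.
  rewrite -(derivation_mulmx derD); last exact: Phi_algebraic.
  apply/matrixP => i j; rewrite -VE !mxE.
  by apply: algebraic_derivation0 => //; exact: algV.
(* The kernel of the chart consists of translations, so [D] moves every vertex of [P'] by the same
   vector [t]. *)
have [t tE] := (hPhi.2 _).1 DhPhi.
have DP k : cder D (P' k) = t.
  by rewrite -(vertex_heights k N2 nP) (cder_vertex derD) // tE vertex_translation.
have c0C : c0%:C != 0 :> R[i] by rewrite fmorph_eq0 lt0r_neq0.
(* Obtained by differentiating [P' k = c0 * b k + d] and solving for the derivative of [b k]. *)
have Db k : cder D (b k) = (- D c0 / c0)%:C * b k + (t - cder D d) / c0%:C.
  have := DP k; rewrite PE (derivationD derC) (cderZ derD) => <-.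
  by rewrite rmorphM rmorphN fmorphV /=; field.
have sumw : \sum_k w k = 0.
  under eq_bigr => k _ do rewrite wE.
  by rewrite -mulr_sumr sumrB sum_ordS subrr mulr0.
have Dw := balanced_rigid derD w1 sumw b_ray Db.
have DLS k : cder D (u / l * (L (ordS k) - L k0)) = cder D (u / l * (L k - L k0)).
  apply/eqP; rewrite -subr_eq0 -(derivationB derC) -mulrBr opprB addrA subrK.
  by rewrite -/(edge L k) -wE Dw.
by move=> k; rewrite (cyclic_const DLS k k0) subrr mulr0 (derivation0 derC).
Qed.
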